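(* Let $A$ be a closed linear operator on a complex Banach lattice $E$. Let $\rho_0\in E_+$ with $D(A)\subset E_{\rho_0}$. Then the following assertions hold. (1) Assume that $\mu+A$ is invertible for some $\mu\in\mathbb{C}$, and that there exists a bounded linear operator $A^{(-1)}_{+,\mu}$ on $E$ that dominates its inverse $(\mu+A)^{-1}$. Then each approximate eigenvalue $\lambda$ of $A$ satisfies $$1\le\inf_{\rho\in\mathcal{Q}^A_+(E)}|\lambda+\mu|\,\|A^{(-1)}_{+,\mu}\rho\|_\rho .$$ (2) If, in particular, $A$ is resolvent-positive, i.e. $(\zeta+A)^{-1}$ is positive for all $\zeta>s(-A)$, then each approximate eigenvalue $\lambda$ of $A$ satisfies $$1\le\inf_{\rho\in\mathcal{Q}^A_+(E)}\ \inf_{\operatorname{Re}\mu>s(-A)}|\operatorname{Re}(\lambda+\mu)|\,\|(\operatorname{Re}\mu+A)^{-1}\rho\|_\rho .$$ (3) If $-A$ generates a positive $C_0$-semigroup $(e^{-tA})_{t\ge 0}$ that is dominated by a further $C_0$-semigroup $(e^{-tB})_{t\ge0}$ on $E$, then each eigenvalue $\lambda$ of $A$ satisfies $$-\inf_{\rho\in\mathcal{Q}^A_+(E)}\ \inf_{t>0}\frac{\log\|e^{-tB}\rho\|_\rho}{t}\le\operatorname{Re}\lambda ,$$ and in particular $$-\inf_{\rho\in\mathcal{Q}^A_+(E)}\ \inf_{t>0}\frac{\log\|e^{-tA}\rho\|_\rho}{t}\le\operatorname{Re}\lambda$$ if $(e^{-tA})_{t\ge0}$ is positive.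
   Context: For $\rho\in E_+$, $E_\rho:=\{f\in E:\exists c\ge0\text{ with }|f|\le c\rho\}$ with gauge norm $\|f\|_\rho:=\inf\{c\ge0:|f|\le c\rho\}$, with $\|f\|_\rho=\infty$ if $f\notin E_\rho$. A vector $\rho\in E_+$ is quasi-interior if $E_\rho$ is dense in $E$. $\mathcal{Q}^A_+(E)$ denotes the set of all quasi-interior points $\rho$ of $E$ such that $D(A)\subset E_\rho$. Infima over the empty set are $+\infty$, and $\log\infty=\infty$. $s(T):=\sup\{\operatorname{Re}\lambda:\lambda\in\sigma(T)\}$ is the spectral bound; in (2) it is understood that $s(-A)<\infty$, so that $\zeta+A$ is invertible for $\zeta>s(-A)$. An operator $T$ dominates $S$ if $|Sf|\le T|f|$ for all $f\in E$; a semigroup dominates another if this holds for the operators at each time $t\ge0$. $\lambda\in\mathbb{C}$ is an approximate eigenvalue of $A$ if there are $\varphi_n\in D(A)$ with $\|\varphi_n\|=1$ and $\|A\varphi_n-\lambda\varphi_n\|\to0$. *)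

(* Defs.v *)
From HB Require Import structures.
From mathcomp Require Import all_boot all_order all_algebra.
From mathcomp Require Import complex.
From mathcomp Require Import all_classical all_reals all_analysis.

Set Implicit Arguments.
Unset Strict Implicit.
Unset Printing Implicit Defensive.

Import Order.TTheory GRing.Theory Num.Theory.
Import numFieldNormedType.Exports.

Local Open Scope classical_set_scope.
Local Open Scope complex_scope.
Local Open Scope ring_scope.

(* A complex Banach lattice is the complexification of a real Banach lattice.
   It is described here from the complex Banach space E: the conjugation
   [vconj] singles out the real part E_R = {f | vconj f = f}, so that
   E = E_R + i E_R; [vpos] is the cone E_+, contained in E_R, whose order makes
   E_R a vector lattice; and [vabs] is the modulus
     |f| = sup_theta Re (e^{i theta} f)      (supremum taken in E_R),
   where Re f = (f + vconj f) / 2.  The norm is the lattice norm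
   ||f|| = || |f| ||.  Since vconj is then isometric, E_R is closed, hence
   itself a (real) Banach lattice. *)
HB.mixin Record isComplexBanachLattice (R : realType) E
    of CompleteNormedModule R[i] E := {
  vconj : E -> E ;
  vpos : set E ;
  vabs : E -> E ;
  vconjD : forall f g, vconj (f + g) = vconj f + vconj g ;
  vconjZ : forall (a : R[i]) f, vconj (a *: f) = conjc a *: vconj f ;
  vconjK : forall f, vconj (vconj f) = f ;
  vpos_real : forall f, vpos f -> vconj f = f ;
  vpos0 : vpos 0 ;
  vposD : forall f g, vpos f -> vpos g -> vpos (f + g) ;
  vposZ : forall (a : R) f, 0 <= a -> vpos f -> vpos (a%:C *: f) ;
  vpos_anti : forall f, vpos f -> vpos (- f) -> f = 0 ;
  vsup_ex : forall f g, vconj f = f -> vconj g = g ->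
    exists h, [/\ vconj h = h, vpos (h - f), vpos (h - g) &
      forall k, vconj k = k -> vpos (k - f) -> vpos (k - g) -> vpos (k - h)] ;
  vabs_real : forall f, vconj (vabs f) = vabs f ;
  vabs_ub : forall f (u : R[i]), `|u| = 1 ->
    vpos (vabs f - 2^-1 *: (u *: f + vconj (u *: f))) ;
  vabs_lub : forall f k, vconj k = k ->
    (forall u : R[i], `|u| = 1 ->
       vpos (k - 2^-1 *: (u *: f + vconj (u *: f)))) ->
    vpos (k - vabs f) ;
  vabs_norm : forall f, `|vabs f| = `|f| ;
  vpos_norm : forall f g, vpos f -> vpos (g - f) -> `|f| <= `|g|
}.

#[short(type="complexBanachLatticeType")]
HB.structure Definition ComplexBanachLattice (R : realType) :=
  {E of isComplexBanachLattice R E & CompleteNormedModule R[i] E}.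

Section BanachLattice.
Context {R : realType} {E : complexBanachLatticeType R}.
Implicit Types (f g rho : E) (S T : E -> E).

Definition vle f g : Prop := vpos (g - f).

Definition gauge_ideal rho : set E :=
  [set f | exists2 c : R, 0 <= c & vle (vabs f) (c%:C *: rho)].

(* Equal to +oo when f is not in gauge_ideal rho. *)
Definition gauge_norm rho f : \bar R :=
  ereal_inf [set c%:E | c in [set c : R | 0 <= c /\
                                          vle (vabs f) (c%:C *: rho)]].

Definition quasi_interior rho : Prop := vpos rho /\ dense (gauge_ideal rho).

Definition positive_op S : Prop := forall f, vpos f -> vpos (S f).

Definition dominates T S : Prop := forall f, vle (vabs (S f)) (T (vabs f)).

End BanachLattice.

(* Possibly unbounded operators; the values of op_fun outside op_dom are
   irrelevant. *)
Record linear_op (K : numFieldType) (E : normedModType K) := LinearOp {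
  op_dom : set E ;
  op_fun :> E -> E ;
  op_dom0 : op_dom 0 ;
  op_domP : forall (a : K) f g, op_dom f -> op_dom g -> op_dom (a *: f + g) ;
  op_funP : forall (a : K) f g, op_dom f -> op_dom g ->
    op_fun (a *: f + g) = a *: op_fun f + op_fun g
}.

Section LinearOp.
Context {K : numFieldType} {E : normedModType K}.
Implicit Types A : linear_op E.

Definition closed_op A : Prop :=
  closed [set p : E * E | op_dom A p.1 /\ p.2 = A p.1].

Fact op_opp_subproof A (a : K) f g : op_dom A f -> op_dom A g ->
  - A (a *: f + g) = a *: (- A f) + - A g.
Proof. by move=> Df Dg; rewrite op_funP// opprD scalerN. Qed.

Definition op_opp A : linear_op E :=
  LinearOp (op_dom0 A) (@op_domP _ _ A) (@op_opp_subproof A).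

Fact op_shift_subproof mu A (a : K) f g : op_dom A f -> op_dom A g ->
  mu *: (a *: f + g) + A (a *: f + g)
  = a *: (mu *: f + A f) + (mu *: g + A g).
Proof.
by move=> Df Dg; rewrite op_funP// !scalerDr !scalerA (mulrC mu) addrACA.
Qed.

(* mu + A *)
Definition op_shift (mu : K) A : linear_op E :=
  LinearOp (op_dom0 A) (@op_domP _ _ A) (@op_shift_subproof mu A).

(* The inverse as a total function; only meaningful when A is invertible. *)
Definition op_inv A (f : E) : E := xget 0 [set g | op_dom A g /\ A g = f].

Definition op_invertible A : Prop :=
  set_bij (op_dom A) [set: E] A /\ continuous (op_inv A).

Definition spectrum A : set K :=
  [set l | ~ op_invertible (op_shift l (op_opp A))].

Definition op_eigenvalue A (l : K) : Prop :=
  exists phi, [/\ op_dom A phi, phi != 0 & A phi = l *: phi].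

Definition op_approx_eigenvalue A (l : K) : Prop :=
  exists phi : nat -> E,
    [/\ forall n, op_dom A (phi n), forall n, `|phi n| = 1 &
        (fun n => A (phi n) - l *: phi n) @ \oo --> (0 : E)].

End LinearOp.

Section Complex.
Context {R : realType}.

Definition spectral_bound (E : normedModType R[i]) (A : linear_op E) : \bar R :=
  ereal_sup [set (complex.Re l)%:E | l in spectrum A].

(* Only the operators T t with 0 <= t are relevant. *)
Record C0_semigroup (E : normedModType R[i]) (T : R -> {linear E -> E}) :
    Prop := {
  C0_continuous : forall t, 0 <= t -> continuous (T t) ;
  C0_0 : forall f, T 0 f = f ;
  C0_D : forall s t f, 0 <= s -> 0 <= t -> T (s + t) f = T s (T t f) ;
  C0_cvg : forall f, T t f @[t --> 0^'+] --> f
}.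

Definition generates (E : normedModType R[i]) (G : linear_op E)
    (T : R -> {linear E -> E}) : Prop :=
  C0_semigroup T /\
  forall f g, (op_dom G f /\ G f = g) <->
    (t^-1)%:C *: (T t f - f) @[t --> 0^'+] --> g.

Variable E : complexBanachLatticeType R.
Implicit Types (A : linear_op E) (S T : R -> {linear E -> E}).

Definition quasi_interior_above A : set E :=
  [set rho | quasi_interior rho /\ op_dom A `<=` gauge_ideal rho].

(* The finiteness of s(-A) is part of the notion. *)
Definition resolvent_positive A : Prop :=
  (spectral_bound (op_opp A) < +oo)%E /\
  forall z : R, (spectral_bound (op_opp A) < z%:E)%E ->
    positive_op (op_inv (op_shift z%:C A)).

Definition positive_semigroup T : Prop :=
  forall t, 0 <= t -> positive_op (T t).

Definition semigroup_dominates T S : Prop :=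
  forall t, 0 <= t -> dominates (T t) (S t).

End Complex.

(* Main.v *)
(* Everything rests on one comparison: if 0 <= f <= a rho, f <= k P f and
   P rho <= c rho with P positive and k c < 1, then f <= a (k c)^n rho for all
   n, hence f = 0.

   (1) If R = (mu + A)^-1, then phi_n = (lambda + mu) R phi_n + R eps_n with
   eps_n -> 0.  Baire's theorem makes R bounded from E to E_rho, so
   |phi_n| <= |lambda + mu| P |phi_n| + O(|eps_n|) rho, and the comparison with
   an additional small multiple of rho contradicts |phi_n| = 1.

   (2) This is (1) at the point Re mu - i Im lambda, once
   |(z + A)^-1 f| <= (Re z + A)^-1 |f| is known for Re z > s(-A).  Expand
   (z + A)^-1 = sum_n (N - z)^n (N + A)^-(n+1) about a large real N; the modulus
   is at most sum_n (N - c)^n (N + A)^-(n+1) |f| <= (c + A)^-1 |f| as soon as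
   |N - z| < N - c, and every c in ]s(-A), Re z[ satisfies this for N large.
   Positivity alone bounds the partial sums at c, so the spectral radius never
   enters.  Finally let c -> Re z.

   (3) For a > Re lambda, differentiability of the orbit of an eigenvector phi
   gives |phi| <= e^(at) (e^(-tA) |phi| + o(t)).  Iterating s/t times yields
   |phi| <= e^(as) e^(-sA) |phi| <= e^(as) e^(-sB) |phi|, and the comparison
   applies with P = e^(-sB), k = e^(as). *)

Require Import Defs.
From HB Require Import structures.
From mathcomp Require Import all_boot all_order all_algebra.
From mathcomp Require Import complex ring lra.
From mathcomp Require Import all_classical all_reals all_analysis.

Set Implicit Arguments.
Unset Strict Implicit.
Unset Printing Implicit Defensive.

Import Order.TTheory GRing.Theory Num.Theory.
Import numFieldNormedType.Exports.

Local Open Scope classical_set_scope.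
Local Open Scope complex_scope.
Local Open Scope ring_scope.

Local Open Scope ring_scope.

(** * Real-valued norm *)

Section RealNorm.
Context {R : realType} {E : normedModType R[i]}.
Implicit Types (f g : E) (a : R[i]) (c : R).

(** The norm of [E] takes values in [R[i]], which is only partially ordered; the real part gives
    access to the total order and the arithmetic of [R]. *)
Definition rnorm f : R := complex.Re `|f|.

Lemma rnormE f : `|f| = (rnorm f)%:C.
Proof. by rewrite /rnorm RRe_real// normr_real. Qed.

Lemma rnorm_ge0 f : 0 <= rnorm f.
Proof. by rewrite -ler0c -rnormE. Qed.

Lemma rnorm0 : rnorm (0 : E) = 0.
Proof. by rewrite /rnorm normr0. Qed.

Lemma rnorm0_eq0 f : rnorm f = 0 -> f = 0.
Proof. by move=> f0; apply/eqP; rewrite -normr_eq0 rnormE f0. Qed.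

Lemma ler_rnormD f g : rnorm (f + g) <= rnorm f + rnorm g.
Proof. by rewrite -lecR rmorphD/= -!rnormE ler_normD. Qed.

Lemma rnormN f : rnorm (- f) = rnorm f.
Proof. by rewrite /rnorm normrN. Qed.

Lemma rnormBC f g : rnorm (f - g) = rnorm (g - f).
Proof. by rewrite /rnorm distrC. Qed.

Lemma ler_rnormB f g : rnorm (f - g) <= rnorm f + rnorm g.
Proof. by rewrite -(rnormN g) ler_rnormD. Qed.

Lemma ler_rnorm_sum n (u : 'I_n -> E) c :
  (forall j, rnorm (u j) <= c) -> rnorm (\sum_j u j) <= n%:R * c.
Proof.
elim: n u => [|n IH] u uc; first by rewrite big_ord0 rnorm0 mul0r.
rewrite big_ord_recr/= -natr1 mulrDl mul1r (le_trans (ler_rnormD _ _))//.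
by apply: lerD => //; exact: IH.
Qed.

Lemma normcC a : `|a| = (Normc.normc a)%:C.
Proof. by case: a. Qed.

Lemma rnormZ a f : rnorm (a *: f) = Normc.normc a * rnorm f.
Proof. by apply: complexI; rewrite rmorphM/= -!rnormE normrZ normcC. Qed.

Lemma normc_ge0 a : 0 <= Normc.normc a.
Proof. by rewrite -ler0c -normcC. Qed.

Lemma normc_real c : Normc.normc c%:C = `|c|.
Proof. by rewrite /= expr0n addr0 sqrtr_sqr. Qed.

Lemma rnormZr c f : rnorm (c%:C *: f) = `|c| * rnorm f.
Proof. by rewrite rnormZ normc_real. Qed.

Lemma rnormZp c f : 0 <= c -> rnorm (c%:C *: f) = c * rnorm f.
Proof. by move=> c0; rewrite rnormZr ger0_norm. Qed.

Lemma gt0_complexE a : 0 < a -> exists2 r : R, 0 < r & a = r%:C.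
Proof.
move=> a0; have aE : a = (complex.Re a)%:C by rewrite RRe_real// gtr0_real.
by exists (complex.Re a) => //; rewrite aE ltcR in a0.
Qed.

(** Turns a bound on a ball into one linear in the norm: [k] brings [f] to norm [r / 2], strictly
    inside the ball of radius [r]. *)
Lemma rescale r f : 0 < r -> f != 0 -> exists2 k : R, 0 < k &
  rnorm (k%:C *: f) < r /\ k^-1 = 2 / r * rnorm f.
Proof.
move=> r0 f0; have f1 : 0 < rnorm f.
  by rewrite lt_neqAle rnorm_ge0 andbT; apply: contraNneq f0 => /esym/rnorm0_eq0/eqP.
exists (r / 2 / rnorm f); first by rewrite !divr_gt0.
split; last by rewrite invf_div invf_div mulrC.
by rewrite rnormZp ?divr_ge0 ?ltW// divfK ?gt_eqF//; lra.
Qed.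

Lemma cvg_rnormP {T : Type} {F : set_system T} {FF : Filter F} (u : T -> E) f :
  u @ F --> f <-> forall e : R, 0 < e -> \forall t \near F, rnorm (f - u t) < e.
Proof.
split=> [/cvgrPdist_lt uf e e0|uf].
  have := uf e%:C; rewrite ltcR => /(_ e0).
  by apply: filterS => t; rewrite rnormE ltcR.
apply/cvgrPdist_lt => _ /gt0_complexE[e e0 ->].
by apply: filterS (uf _ e0) => t; rewrite rnormE ltcR.
Qed.

Lemma closed_rnormP (S : set E) : closed S <->
  forall f, (forall e : R, 0 < e -> exists2 g, S g & rnorm (f - g) < e) -> S f.
Proof.
split=> [cS f fS|cS f fS].
  apply: cS => B /nbhs_ballP[_ /gt0_complexE[e e0 ->] eB].
  have [g Sg fg] := fS _ e0; exists g; split => //; apply: eB.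
  by rewrite -ball_normE/= rnormE ltcR.
apply: cS => e e0; have : nbhs f (ball f e%:C) by apply: nbhsx_ballx; rewrite ltcR.
by move=> /fS[g [Sg]]; rewrite -ball_normE/= rnormE ltcR; exists g.
Qed.

Lemma continuous_rnorm_bound (T : {linear E -> E}) : continuous T ->
  exists2 M : R, 0 <= M & forall f, rnorm (T f) <= M * rnorm f.
Proof.
move=> /(_ 0)/cvg_rnormP/(_ 1 ltr01).
rewrite linear0 => /nbhs_ballP[_ /gt0_complexE[r r0 ->] rT].
exists (2 / r) => [|f]; first by rewrite divr_ge0// ltW.
have [->|f0] := eqVneq f 0; first by rewrite linear0 rnorm0 mulr0.
have [k k0 [kf <-]] := rescale r0 f0.
rewrite -[k^-1]mulr1 ler_pdivlMl// -rnormZp ?ltW// -linearZ -rnormN -sub0r.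
by apply: rT; rewrite -ball_normE/= sub0r normrN rnormE ltcR.
Qed.

End RealNorm.

(** * Order and modulus *)

Section Order.
Context {R : realType} {E : complexBanachLatticeType R}.
Implicit Types (f g h k : E) (a u : R[i]) (c d : R).

Lemma vle_refl f : vle f f.
Proof. by rewrite /vle subrr; exact: vpos0. Qed.

Lemma vle0 f : vle 0 f <-> vpos f.
Proof. by rewrite /vle subr0. Qed.

Lemma vle_trans g f h : vle f g -> vle g h -> vle f h.
Proof. by move=> fg gh; rewrite /vle -(subrKA g); exact: vposD. Qed.

Lemma vleD f g h k : vle f g -> vle h k -> vle (f + h) (g + k).
Proof. by move=> fg hk; rewrite /vle opprD addrACA; exact: vposD. Qed.

Lemma vle_anti f g : vle f g -> vle g f -> f = g.
Proof.
move=> fg gf; apply/esym/eqP; rewrite -subr_eq0; apply/eqP/vpos_anti => //.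
by rewrite opprB.
Qed.

Lemma vleZ c f g : 0 <= c -> vle f g -> vle (c%:C *: f) (c%:C *: g).
Proof. by move=> c0 fg; rewrite /vle -scalerBr; exact: vposZ. Qed.

Lemma vleZl c d f : c <= d -> vpos f -> vle (c%:C *: f) (d%:C *: f).
Proof.
by move=> cd f0; rewrite /vle -scalerBl -rmorphB; apply: vposZ; rewrite ?subr_ge0.
Qed.

Lemma vle_rnorm f g : vpos f -> vle f g -> rnorm f <= rnorm g.
Proof. by move=> f0 fg; rewrite -lecR -!rnormE vpos_norm. Qed.

Lemma vleDr f g : vpos g -> vle f (f + g).
Proof. by move=> g0; rewrite /vle addrC addKr. Qed.

Lemma vconj0 : vconj (0 : E) = 0.
Proof. by rewrite -(scale0r (0 : E)) vconjZ conjc0 !scale0r. Qed.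

Lemma vconjN f : vconj (- f) = - vconj f.
Proof. by rewrite -scaleN1r vconjZ rmorphN rmorph1 scaleN1r. Qed.

Lemma vconjB f g : vconj (f - g) = vconj f - vconj g.
Proof. by rewrite vconjD vconjN. Qed.

Lemma halfC : 2^-1 = (2^-1 : R)%:C.
Proof. by rewrite fmorphV/= rmorph_nat. Qed.

Definition vre f : E := 2^-1 *: (f + vconj f).

Lemma vreD f g : vre (f + g) = vre f + vre g.
Proof. by rewrite /vre vconjD addrACA scalerDr. Qed.

Lemma vconj_realZ c f : vconj (c%:C *: f) = c%:C *: vconj f.
Proof. by rewrite vconjZ conjc_real. Qed.

Lemma vreZr c f : vre (c%:C *: f) = c%:C *: vre f.
Proof. by rewrite /vre vconj_realZ -scalerDr !scalerA mulrC. Qed.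

Lemma vre_real f : vconj f = f -> vre f = f.
Proof.
move=> fr; rewrite /vre fr -mulr2n -[f *+ 2]scaler_nat scalerA mulVf ?scale1r//.
Qed.

Lemma vreZ_real a f : vconj f = f -> vre (a *: f) = (complex.Re a)%:C *: f.
Proof.
by move=> fr; rewrite /vre vconjZ fr -scalerDl scalerA mulrC -ReJ_add.
Qed.

Lemma vconj_vre f : vconj (vre f) = vre f.
Proof.
by rewrite /vre halfC vconj_realZ vconjD vconjK addrC.
Qed.

Lemma vre_vabs f u : `|u| = 1 -> vle (vre (u *: f)) (vabs f).
Proof. by move=> u1; exact: vabs_ub. Qed.

Lemma vabs_le f k : vconj k = k ->
  (forall u, `|u| = 1 -> vle (vre (u *: f)) k) -> vle (vabs f) k.
Proof. by move=> kr fk; exact: vabs_lub. Qed.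

Lemma Re_unit u : `|u| = 1 -> -1 <= complex.Re u <= 1.
Proof. by move=> u1; rewrite -ler_norml -lecR (le_trans (normc_ge_Re u))// u1. Qed.

(** For real [h] the real part of [u *: h] is [Re u] times [h], a convex combination of [h] and
    [- h] because [Re u] lies between -1 and 1. *)
Lemma vabs_le_real h k : vle h k -> vle (- h) k -> vconj h = h -> vconj k = k ->
  vle (vabs h) k.
Proof.
move=> hk nhk hr kr; apply: vabs_le => // u /Re_unit/andP[u1 u2].
rewrite vreZ_real//; set c := complex.Re u in u1 u2 *.
have -> : k = ((1 + c) / 2)%:C *: k + ((1 - c) / 2)%:C *: k.
  rewrite -scalerDl -rmorphD -mulrDl addrACA subrr addr0 divff ?scale1r//.
have -> : c%:C *: h = ((1 + c) / 2)%:C *: h + ((1 - c) / 2)%:C *: - h.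
  rewrite scalerN -scalerBl -rmorphB; congr (_%:C *: _).
  by field.
by apply: vleD; apply: vleZ => //; lra.
Qed.

(** The real parts of [f] and [- f] lie below the modulus ([u = 1] and [u = -1]) and sum to 0, so
    twice the modulus is positive. *)
Lemma vabs_ge0 f : vpos (vabs f).
Proof.
have := vleD (@vre_vabs f 1 (normr1 _)) (@vre_vabs f (-1) (normrN1 _)).
rewrite -vreD -scalerDl subrr scale0r vre_real ?vconj0// vle0 => f0.
rewrite -(vre_real (vabs_real f)) /vre vabs_real halfC.
by apply: vposZ => //; rewrite invr_ge0.
Qed.

Lemma vabs_ge f : vconj f = f -> vle f (vabs f).
Proof. by move=> fr; have := @vre_vabs f 1 (normr1 _); rewrite scale1r vre_real. Qed.

Lemma vabs_pos f : vpos f -> vabs f = f.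
Proof.
move=> f0; have fr := vpos_real _ f0; apply: vle_anti; last exact: vabs_ge.
apply: vabs_le_real => //; first exact: vle_refl.
by rewrite /vle opprK; exact: vposD.
Qed.

Lemma rnorm_vabs f : rnorm (vabs f) = rnorm f.
Proof. by rewrite /rnorm vabs_norm. Qed.

Lemma vabsD f g : vle (vabs (f + g)) (vabs f + vabs g).
Proof.
apply: vabs_le => [|u u1]; first by rewrite vconjD !vabs_real.
by rewrite scalerDr vreD; apply: vleD; exact: vre_vabs.
Qed.

Lemma vabsN f : vabs (- f) = vabs f.
Proof.
suff H g : vle (vabs (- g)) (vabs g).
  by apply: vle_anti => //; rewrite -[f in vle (vabs f)]opprK.
apply: vabs_le => [|u u1]; first exact: vabs_real.
by rewrite scalerN -scaleNr; apply: vre_vabs; rewrite normrN.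
Qed.

Lemma vabsZ_le a f : vle (vabs (a *: f)) ((Normc.normc a)%:C *: vabs f).
Proof.
apply: vabs_le => [|u u1]; first by rewrite vconj_realZ vabs_real.
have [->|a0] := eqVneq a 0.
  rewrite scale0r scaler0 vre_real ?vconj0//.
  by apply/vle0/vposZ; [exact: normc_ge0|exact: vabs_ge0].
have na0 : `|a| != 0 by rewrite normr_eq0.
(* The phase of [a] is absorbed into the unit scalar [u]. *)
have -> : u *: (a *: f) = (Normc.normc a)%:C *: ((u * (a / `|a|)) *: f).
  by rewrite !scalerA -normcC; congr (_ *: f); rewrite [RHS]mulrCA [`|a| * _]mulrC divfK.
rewrite vreZr; apply: vleZ; first exact: normc_ge0.
by apply: vre_vabs; rewrite normrM u1 mul1r normrM normfV normr_id divff.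
Qed.

Lemma vabsZ a f : vabs (a *: f) = (Normc.normc a)%:C *: vabs f.
Proof.
apply: vle_anti; first exact: vabsZ_le.
have [->|a0] := eqVneq a 0.
  rewrite -normcC normr0 !scale0r; exact/vle0/vabs_ge0.
have := vabsZ_le a^-1 (a *: f).
rewrite scalerA mulVf// scale1r => /(vleZ (normc_ge0 a)).
by rewrite scalerA -!normcC -normrM divff// normr1 scale1r.
Qed.

Lemma vabs_lip f g : rnorm (vabs f - vabs g) <= rnorm (f - g).
Proof.
have H h k : vle (vabs h - vabs k) (vabs (h - k)).
  have := vleD (vabsD (h - k) k) (vle_refl (- vabs k)).
  by rewrite subrK addrK.
rewrite -(rnorm_vabs (_ - vabs g)) -(rnorm_vabs (f - g)).
apply: vle_rnorm; first exact: vabs_ge0.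
have vB : vconj (vabs f - vabs g) = vabs f - vabs g.
  by rewrite vconjB !vabs_real.
apply: vabs_le_real => //; last exact: vabs_real.
by rewrite opprB -(vabsN (f - g)) opprB; exact: H.
Qed.

(** Closedness of the cone. Since [f + w] is its own modulus and the modulus is 1-Lipschitz,
    [vabs f - f] has norm at most twice that of [w]. *)
Lemma vpos_approx f :
  (forall e : R, 0 < e -> exists2 w, rnorm w < e & vpos (f + w)) -> vpos f.
Proof.
move=> fw; suff -> : f = vabs f by exact: vabs_ge0.
apply/eqP; rewrite eq_sym -subr_eq0; apply/eqP/rnorm0_eq0/eqP.
rewrite eq_le rnorm_ge0 andbT; apply/ler_addgt0Pr => e e0; rewrite add0r.
have [|w we w0] := fw (e / 2); first by rewrite divr_gt0.
have -> : vabs f - f = vabs f - vabs (f + w) + w.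
  by rewrite (vabs_pos w0) opprD addrA subrK.
rewrite (splitr e); apply: (le_trans (ler_rnormD _ _)).
apply: lerD; last exact: ltW.
rewrite (le_trans (vabs_lip _ _))// opprD addrA subrr sub0r rnormN.
exact: ltW.
Qed.

Lemma vle_approx f g :
  (forall e : R, 0 < e -> exists2 w, rnorm w < e & vle f (g + w)) -> vle f g.
Proof.
move=> fg; apply: vpos_approx => e /fg[w we gw]; exists w => //.
by rewrite addrAC.
Qed.

Lemma positive_vmono (P : {linear E -> E}) f g :
  positive_op P -> vle f g -> vle (P f) (P g).
Proof. by move=> P0 fg; rewrite /vle -linearB; exact: P0. Qed.

Lemma dominates_positive (P S : E -> E) : dominates P S -> positive_op P.
Proof.
move=> PS f f0; rewrite -(vabs_pos f0); apply/vle0.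
by apply: (vle_trans _ (PS f)); apply/vle0/vabs_ge0.
Qed.

(** A real vector is a difference of positive ones, so [P] preserves real vectors and therefore
    commutes with [vre]. Then [vre (u *: P f)] is [P (vre (u *: f))], and monotonicity applies. *)
Lemma positive_dominates (P : {linear E -> E}) : positive_op P -> dominates P P.
Proof.
move=> P0 f.
have Preal g : vconj g = g -> vconj (P g) = P g.
  move=> gr; have -> : g = vabs g - (vabs g - g) by rewrite opprB addrC subrK.
  rewrite linearB/= vconjB.
  by rewrite !(vpos_real (P _))//; apply: P0; [exact: vabs_ge|exact: vabs_ge0].
(* The imaginary part [z] of [g] is mapped to an imaginary vector because
   ['i *: z] is real. *)
have Pvre g : vre (P g) = P (vre g).
  pose z := g - vre g.
  have zE : vconj z = - z.
    apply/eqP; rewrite -addr_eq0 /z vconjB vconj_vre addrACA -opprD subr_eq0.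
    by rewrite /vre -scalerDl -[2^-1]mul1r -splitr scale1r addrC.
  have iz : vconj (P ('i *: z)) = P ('i *: z).
    apply: Preal; rewrite vconjZ zE scalerN -scaleNr; congr (_ *: _).
    by apply/eqP; rewrite eq_complex /= oppr0 opprK !eqxx.
  have Pz : vre (P z) = 0.
    have -> : P z = - 'i *: P ('i *: z).
      by rewrite linearZ/= scalerA mulNr -expr2 sqr_i opprK scale1r.
    by rewrite vreZ_real// /= oppr0 scale0r.
  rewrite -[in LHS](subrK (vre g) g) -/z linearD vreD Pz add0r vre_real//.
  exact/Preal/vconj_vre.
apply: vabs_le => [|u u1]; first exact/vpos_real/P0/vabs_ge0.
by rewrite -linearZ Pvre; apply: positive_vmono => //; exact: vre_vabs.
Qed.

End Order.

(** * Baire's theorem over the complex scalars *)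

Lemma expr_small {R : realType} (q e : R) : 0 <= q -> q < 1 -> 0 < e ->
  exists n, q ^+ n < e.
Proof.
move=> q0 q1 e0.
have := @cvg_expr R q; rewrite ger0_norm// => /(_ q1)/cvgrPdist_lt/(_ e e0)[n _ nq].
exists n; have := nq n (leqnn n).
by rewrite /= sub0r normrN ger0_norm// exprn_ge0.
Qed.

Section Baire.
Context {R : realType} {E : completeNormedModType R[i]}.
Implicit Types (f g : E) (F : nat -> set E).

Lemma rnorm_cauchy_cvg (x : nat -> E) (r : nat -> R) :
  (forall n k, rnorm (x (n + k)%N - x n) <= r n) ->
  (forall e : R, 0 < e -> exists n, r n < e) ->
  exists l, forall n, rnorm (l - x n) <= r n.
Proof.
move=> xr r0.
have : cvg (x @ \oo).
  suff : cauchy_ex (x @ \oo) by move/cauchy_exP; exact: cauchy_cvg.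
  move=> _ /gt0_complexE[e e0 ->]; have [n rn] := r0 _ e0.
  exists (x n); exists n => // m /= nm.
  rewrite -ball_normE/= rnormE ltcR rnormBC -(subnKC nm).
  exact: le_lt_trans (xr _ _) rn.
move=> /cvg_ex[l /cvg_rnormP xl]; exists l => n.
apply/ler_addgt0Pr => e e0; have [m _ mx] := xl e e0.
rewrite -(subrKA (x (n + m)%N)) addrC.
apply: (le_trans (ler_rnormD _ _)); apply: lerD; first exact: xr.
by apply/ltW/mx => /=; exact: leq_addl.
Qed.

(** If no [F n] contained a ball, every ball would contain a smaller closed ball missing [F n];
    shrinking balls chosen for successive [n] converge to a point outside every [F n]. *)
Lemma baire_cover F : (forall n, closed (F n)) -> (forall f, exists n, F n f) ->
  exists n, exists f0, exists2 r : R, 0 < r &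
    forall g, rnorm (g - f0) < r -> F n g.
Proof.
move=> cF covF; apply: contrapT => noball.
(* A ball is a pair of centre and radius. Positivity of the radius is a premise inside the
   existential, so that choice yields a total function. *)
have step (p : nat * (E * R)) : exists q : E * R, 0 < p.2.2 ->
    [/\ 0 < q.2, q.2 <= p.2.2 / 2, rnorm (q.1 - p.2.1) + q.2 <= p.2.2 &
        forall g, rnorm (g - q.1) <= q.2 -> ~ F p.1 g].
  case: p => n [x r] /=; have [r0|r0] := ltP 0 r; last by exists (0, 0).
  have [y yx Fy] : exists2 y, rnorm (y - x) < r & ~ F n y.
    apply: contrapT => H; apply: noball; exists n, x, r => // g gr.
    by apply: contrapT => Fg; apply: H; exists g.
  have [e e0 eF] : exists2 e : R, 0 < e & forall g, rnorm (g - y) < e -> ~ F n g.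
    apply: contrapT => H; apply: Fy; move/closed_rnormP: (cF n); apply => e e0.
    apply: contrapT => H'; apply: H; exists e => // g ge Fg.
    by apply: H'; exists g; rewrite 1?rnormBC.
  (* The closed ball of radius [s / 2] about [y] misses [F n], stays inside the previous ball and
     has at most half its radius. *)
  pose s := Num.min e (Num.min (r - rnorm (y - x)) r).
  have s0 : 0 < s by rewrite !lt_min e0 r0 subr_gt0 yx.
  have [se sr sr'] : [/\ s <= e, s <= r - rnorm (y - x) & s <= r].
    by rewrite !ge_min !lexx ?orbT.
  exists (y, s / 2) => _ /=; split; [lra|lra|lra|].
  by move=> g gs; apply: eF; lra.
have [st stP] := choice step.
pose fix u n := if n is m.+1 then st (m, u m) else (0 : E, 1 : R).
have u0 n : 0 < (u n).2 by elim: n => //= n /(stP (n, u n))[].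
have uS n := stP (n, u n) (u0 n).
have uk n k : rnorm ((u (n + k)%N).1 - (u n).1) + (u (n + k)%N).2 <= (u n).2.
  elim: k => [|k IH]; first by rewrite addn0 subrr rnorm0 add0r.
  rewrite addnS; have [_ _ /= + _] := uS (n + k)%N.
  have := ler_rnormD ((u (n + k).+1).1 - (u (n + k)%N).1) ((u (n + k)%N).1 - (u n).1).
  rewrite subrKA /=; lra.
have [l lu] : exists l, forall n, rnorm (l - (u n).1) <= (u n).2.
  apply: rnorm_cauchy_cvg => [n k|e e0].
    by have := uk n k; have := u0 (n + k)%N; lra.
  have u2 n : (u n).2 <= 2^-1 ^+ n.
    elim: n => [|n IH]; first by rewrite expr0.
    by rewrite exprS; have [_ /= + _ _] := uS n; lra.
  have [||n ne] := @expr_small R 2^-1 e _ _ e0; [lra|lra|].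
  by exists n; exact: le_lt_trans (u2 n) ne.
have [n Fl] := covF l.
by have [_ _ _ /(_ l (lu n.+1))] := uS n.
Qed.

End Baire.

(** * Approximate eigenvalues *)

Section Inverse.
Context {K : numFieldType} {E : normedModType K}.
Variables (A : linear_op E) (Ainv : op_invertible A).

Lemma op_invP f : op_dom A (op_inv A f) /\ A (op_inv A f) = f.
Proof.
have [[_ _ surj] _] := Ainv.
have [g Dg gf] := surj f I.
by apply: (xgetPex 0 (P := [set g | op_dom A g /\ A g = f])); exists g.
Qed.

Lemma op_invK g : op_dom A g -> op_inv A (A g) = g.
Proof.
move=> Dg; have [[_ inj _] _] := Ainv.
by have [D' e] := op_invP (A g); apply: inj; rewrite ?inE.
Qed.

Lemma op_inv_is_linear : exists L : {linear E -> E}, forall f, L f = op_inv A f.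
Proof.
have lin : linear (op_inv A).
  move=> a f g; have [Df Af] := op_invP f; have [Dg Ag] := op_invP g.
  by rewrite -{1}Af -{1}Ag -op_funP// op_invK//; exact: op_domP.
pose L : {linear E -> E} :=
  HB.pack (op_inv A) (GRing.isLinear.Build _ _ _ _ _ lin).
by exists L.
Qed.

End Inverse.

(** * Estimates in the principal ideal generated by rho *)

Section Gauge.
Context {R : realType} {E : complexBanachLatticeType R}.
Implicit Types (f g rho : E) (P : {linear E -> E}).

Lemma gauge_norm_ge rho f (x : \bar R) :
  (forall c : R, 0 <= c -> vle (vabs f) (c%:C *: rho) -> (x <= c%:E)%E) ->
  (x <= gauge_norm rho f)%E.
Proof. by move=> H; apply/ereal_infP => _ [c [c0 fc] <-]; exact: H. Qed.

(* If [f <= b rho], then also [f <= (k c b + d) rho]; iterate. *)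
Lemma gauge_iter P rho f (a c d k : R) : positive_op P -> vpos rho -> vpos f ->
  0 <= a -> 0 <= c -> 0 <= d -> 0 <= k -> k * c < 1 ->
  vle f (a%:C *: rho) -> vle f (k%:C *: P f + d%:C *: rho) ->
  vle (P rho) (c%:C *: rho) -> rnorm f <= d / (1 - k * c) * rnorm rho.
Proof.
move=> P0 rho0 f0 a0 c0 d0 k0 kc fa fP Pc.
pose t := k * c; have t0 : 0 <= t by rewrite mulr_ge0.
have t1 : 0 < 1 - t by rewrite subr_gt0.
(* Solution of the recursion [b n.+1 = k * c * b n + d], started above [a]; its limit [d / (1 - t)]
   is the final bound. *)
pose b n := t ^+ n * a + d / (1 - t).
have b0 n : 0 <= b n by rewrite addr_ge0 ?mulr_ge0 ?exprn_ge0// invr_ge0 ltW.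
have bS n : b n.+1 = k * (b n * c) + d.
  rewrite /b exprS /t; field; exact: lt0r_neq0.
have fb n : vle f ((b n)%:C *: rho).
  elim: n => [|n IH].
    by apply: (vle_trans fa); apply: vleZl => //; rewrite /b expr0 mul1r lerDl divr_ge0// ltW.
  apply: (vle_trans fP); rewrite bS rmorphD rmorphM scalerDl -scalerA.
  apply: vleD; last exact: vle_refl.
  apply: vleZ => //; apply: (vle_trans (positive_vmono P0 IH)).
  by rewrite linearZ/= rmorphM -scalerA; exact: vleZ.
apply/ler_addgt0Pr => e e0.
pose e' := e / (a * rnorm rho + 1).
have r0 := rnorm_ge0 rho.
have ar : 0 < a * rnorm rho + 1 by rewrite ltr_wpDl// mulr_ge0.
have [|n ne] := expr_small t0 kc (e := e'); first by rewrite divr_gt0.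
have := vle_rnorm f0 (fb n); rewrite rnormZp// => /le_trans; apply.
rewrite /b mulrDl addrC lerD2l -mulrA.
move: ne; rewrite ltr_pdivlMr// => /ltW; apply: le_trans.
by rewrite ler_wpM2l ?exprn_ge0// lerDl.
Qed.

(** Baire's theorem applies to the sets [F n], closed because [P] is continuous and the modulus
    Lipschitz. Subtracting the centre of a ball inside some [F n] bounds [P] near 0, and rescaling
    does the rest. *)
Lemma gauge_bound P rho : vpos rho -> continuous P ->
  (forall f, gauge_ideal rho (P f)) ->
  exists2 M : R, 0 <= M & forall f, vle (vabs (P f)) ((M * rnorm f)%:C *: rho).
Proof.
move=> rho0 /continuous_rnorm_bound[N N0 PN] Prho.
pose F n := [set f | vle (vabs (P f)) (n%:R%:C *: rho)].
have [n|f|n [f0 [r r0 rF]]] := @baire_cover R E F.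
- apply/closed_rnormP => f fF; apply: vle_approx => e e0.
  have [|g gF] := fF (e / (N + 1)); first by rewrite divr_gt0// ltr_wpDl.
  rewrite ltr_pdivlMr ?ltr_wpDl// => fg.
  exists (vabs (P f) - vabs (P g)); last first.
    have := vleD gF (vle_refl (vabs (P f) - vabs (P g))).
    by rewrite addrC subrK.
  apply: (le_lt_trans (vabs_lip _ _)); rewrite -linearB.
  apply: (le_lt_trans (PN _)); apply: le_lt_trans fg.
  by rewrite mulrDr mulr1 mulrC lerDl rnorm_ge0.
- have [c c0 fc] := Prho f; exists (Num.truncn c).+1.
  apply: (vle_trans fc); apply: vleZl => //; apply/ltW; exact: truncnS_gt.
exists (2 * n%:R * 2 / r); first by rewrite divr_ge0 ?mulr_ge0// ltW.
have small g : rnorm g < r -> vle (vabs (P g)) ((2 * n%:R)%:C *: rho).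
  move=> gr; have := vabsD (P (g + f0)) (- P f0).
  rewrite -linearB addrK vabsN => /vle_trans; apply.
  rewrite mulr_natl mulr2n rmorphD scalerDl.
  by apply: vleD; apply: rF; rewrite ?addrK// subrr rnorm0.
move=> f; have [->|fN0] := eqVneq f 0.
  rewrite linear0 vabs_pos; last exact: vpos0.
  by rewrite rnorm0 mulr0 scale0r; exact: vle_refl.
have [k k0 [kf kE]] := rescale r0 fN0.
have := vleZ (c := k^-1) _ (small _ kf).
rewrite invr_ge0 ltW// => /(_ isT).
rewrite linearZ/= vabsZ normc_real gtr0_norm// !scalerA -!rmorphM.
rewrite mulVf ?gt_eqF// scale1r kE.
by congr (vle _ (_%:C *: _)); ring.
Qed.

End Gauge.

Section ApproxEigenvalue.
Context {R : realType} {E : complexBanachLatticeType R}.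
Implicit Types (A : linear_op E) (P : {linear E -> E}).

Lemma approx_eigenvalue_gauge A (mu l : R[i]) P (rho : E) :
  op_invertible (op_shift mu A) -> dominates P (op_inv (op_shift mu A)) ->
  op_approx_eigenvalue A l -> vpos rho -> op_dom A `<=` gauge_ideal rho ->
  (1 <= (Normc.normc (l + mu))%:E * gauge_norm rho (P rho))%E.
Proof.
move=> Ainv PR [phi [Dphi phi1 /cvg_rnormP philim]] rho0 Drho.
have [L LE] := op_inv_is_linear Ainv.
have P0 := dominates_positive PR.
have PL f : vle (vabs (L f)) (P (vabs f)) by rewrite LE; exact: PR.
have [|f|M M0 LM] := gauge_bound (P := L) rho0.
- by have := Ainv.2; rewrite (_ : op_inv _ = L)//; apply/funext.
- by rewrite LE; apply: Drho; have [] := op_invP Ainv f.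
pose eps n := A (phi n) - l *: phi n.
pose k := Normc.normc (l + mu).
have k0 : 0 <= k := normc_ge0 _.
have small C : 0 <= C -> exists n, C * rnorm (eps n) < 1.
  move=> C0; have [|n _ nC] := philim (C + 1)^-1; first by rewrite invr_gt0 ltr_wpDl.
  exists n; have := nC n (leqnn n).
  rewrite sub0r rnormN -/(eps n) -[_^-1]mul1r ltr_pdivlMr ?ltr_wpDl//.
  by apply: le_lt_trans; rewrite mulrDr mulr1 mulrC lerDl rnorm_ge0.
(* The inverse applied to [(mu + A) (phi n) = (l + mu) *: phi n + eps n]. *)
have phiE n : phi n = (l + mu) *: L (phi n) + L (eps n).
  rewrite -linearP LE -[LHS](op_invK Ainv)//=; congr op_inv.
  by rewrite /eps scalerDl [RHS]addrC subrKA addrC.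
have Leps n : vle (vabs (phi n))
    (k%:C *: vabs (L (phi n)) + (M * rnorm (eps n))%:C *: rho).
  rewrite {1}phiE; apply: (vle_trans (vabsD _ _)); rewrite vabsZ.
  by apply: vleD; [exact: vle_refl|exact: LM].
have rphi n : rnorm (vabs (phi n)) = 1 by rewrite rnorm_vabs /rnorm phi1.
have rr := rnorm_ge0 rho.
(* If [l + mu] were 0, the modulus of [phi n] would lie below [M * rnorm (eps n)] times [rho],
   against norm 1 for large [n]. *)
have kN0 : 0 < k.
  rewrite lt_neqAle k0 andbT; apply/eqP => /esym k0'.
  have [n] := small _ (mulr_ge0 M0 rr).
  have := vle_rnorm (vabs_ge0 _) (Leps n).
  rewrite k0' scale0r add0r rnormZp ?mulr_ge0 ?rnorm_ge0// rphi.
  by rewrite mulrAC => /le_lt_trans h /h; rewrite ltxx.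
rewrite -lee_pdivrMl// mule1; apply: gauge_norm_ge => c c0.
rewrite vabs_pos; last exact: P0.
move=> Prho; rewrite lee_fin leNgt; apply/negP => ck.
have kc : k * c < 1 by rewrite mulrC -ltr_pdivlMr// mul1r.
have kc0 : 0 < 1 - k * c by rewrite subr_gt0.
have [|n] := small (M / (1 - k * c) * rnorm rho).
  by rewrite !mulr_ge0// invr_ge0 ltW.
(* The constant [a] depends on [n], but the conclusion of [gauge_iter] does not involve it. *)
have [a a0 phia] := Drho _ (Dphi n).
have := @gauge_iter _ _ P rho (vabs (phi n)) a c (M * rnorm (eps n)) k P0 rho0
  (vabs_ge0 _) a0 c0 (mulr_ge0 M0 (rnorm_ge0 _)) k0 kc phia.
have -> : M * rnorm (eps n) / (1 - k * c) * rnorm rho =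
   M / (1 - k * c) * rnorm rho * rnorm (eps n) by ring.
rewrite rphi => H lt1; have /le_lt_trans/(_ lt1) : 1 <= M / (1 - k * c) * rnorm rho * rnorm (eps n).
  apply: H => //; apply: (vle_trans (Leps n)); apply: vleD; last exact: vle_refl.
  exact: vleZ.
by rewrite ltxx.
Qed.

End ApproxEigenvalue.

(** * Resolvents of resolvent-positive operators *)

Section Iterates.
Context {R : realType} {E : complexBanachLatticeType R}.
Implicit Types (f g : E) (d : R[i]) (e : R).
Variable T : {linear E -> E}.

Lemma iterP m d f g : iter m T (d *: f + g) = d *: iter m T f + iter m T g.
Proof. by elim: m => //= m ->; rewrite linearP. Qed.

Hypothesis T0 : positive_op T.

Lemma iter_pos m f : vpos f -> vpos (iter m T f).
Proof. by move=> f0; elim: m => //= m; exact: T0. Qed.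

Lemma vabs_iter m f : vle (vabs (iter m T f)) (iter m T (vabs f)).
Proof.
elim: m => [|m IH] /=; first exact: vle_refl.
by apply: (vle_trans (positive_dominates T0 _)); exact: positive_vmono.
Qed.

(** For [T = (N + A)^-1], a partial sum of the expansion of [(N - d + A)^-1 f] about [N]. *)
Definition neumann d m f : E := \sum_(n < m) d ^+ n *: iter n.+1 T f.

Lemma neumannS d m f : neumann d m.+1 f = neumann d m f + d ^+ m *: iter m.+1 T f.
Proof. by rewrite /neumann big_ord_recr. Qed.

(** The equation for [g] is substituted into itself repeatedly. Keeping the exact remainder
    postpones any question of convergence. *)
Lemma neumann_rem d f g m : g = T f + d *: T g ->
  g = neumann d m f + d ^+ m *: iter m T g.
Proof.
move=> gE; elim: m => [|m IH]; first by rewrite /neumann big_ord0 expr0 scale1r add0r.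
rewrite neumannS -addrA {1}IH; congr (_ + _).
by rewrite {1}gE [T f + _]addrC iterP -!iterSr scalerDr scalerA -exprSr addrC.
Qed.

Lemma vabs_neumann d e m f : Normc.normc d <= e ->
  vle (vabs (neumann d m f)) (neumann e%:C m (vabs f)).
Proof.
move=> de; elim: m => [|m IH].
  by rewrite /neumann !big_ord0 vabs_pos; [exact: vle_refl|exact: vpos0].
rewrite !neumannS; apply: (vle_trans (vabsD _ _)); apply: vleD => //.
rewrite vabsZ -normcC normrX normcC -!rmorphXn.
apply: (@vle_trans _ _ ((Normc.normc d ^+ m)%:C *: iter m.+1 T (vabs f))).
  by apply: vleZ; [rewrite exprn_ge0// normc_ge0|exact: vabs_iter].
apply: vleZl; last exact/iter_pos/vabs_ge0.
by apply: lerXn2r => //; rewrite nnegrE ?normc_ge0// (le_trans (normc_ge0 d)).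
Qed.

Lemma neumann_pos e m f : 0 <= e -> vpos f -> vpos (neumann e%:C m f).
Proof.
move=> e0 f0; elim: m => [|m IH]; first by rewrite /neumann big_ord0; exact: vpos0.
rewrite neumannS -rmorphXn; apply: vposD => //; apply: vposZ; last exact: iter_pos.
exact: exprn_ge0.
Qed.

Lemma neumann_le e m f g : 0 <= e -> vpos g -> g = T f + e%:C *: T g ->
  vle (neumann e%:C m f) g.
Proof.
move=> e0 g0 gE; rewrite [g in vle _ g](neumann_rem m gE); apply: vleDr.
by rewrite -rmorphXn; apply: vposZ; [exact: exprn_ge0|exact: iter_pos].
Qed.

End Iterates.

(** * Domination for families [Q] satisfying the resolvent identity *)

Section ResolventDomination.
Context {R : realType} {E : complexBanachLatticeType R}.
Variables (c0 : R) (Q : R[i] -> {linear E -> E}).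
Hypothesis resolvent_eq : forall z w f, c0 < complex.Re z -> c0 < complex.Re w ->
  Q w f = Q z f + (z - w) *: Q z (Q w f).
Hypothesis Q0 : forall c : R, c0 < c -> positive_op (Q c%:C).

(** Partial sums about [N] for [z] are dominated by those with [e] in place of [d], which stay below
    [Q c] at [vabs f]. The remainder for [z] must then be shown to vanish. *)
Lemma resolvent_le_disc (N c : R) z f : c0 < c -> c0 < complex.Re z ->
  Normc.normc (N%:C - z) < N - c -> vle (vabs (Q z f)) (Q c%:C (vabs f)).
Proof.
move=> c0c c0z; set d := N%:C - z; set e := N - c => de.
have d0 := normc_ge0 d.
have e0 : 0 < e by exact: le_lt_trans de.
have c0N : c0 < N by apply: (lt_trans c0c); rewrite -subr_gt0.
pose T := Q N%:C; have T0 : positive_op T := Q0 c0N.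
have Qc g : Q c%:C g = T g + e%:C *: T (Q c%:C g).
  by rewrite {1}(@resolvent_eq N%:C)// rmorphB.
have Qz : Q z f = T f + d *: T (Q z f) by exact: resolvent_eq.
pose h := vabs (Q z f).
have Qc0 g : vpos g -> vpos (Q c%:C g) by move=> g0; exact: Q0.
pose q := Normc.normc d / e.
have q0 : 0 <= q by rewrite divr_ge0// ltW.
have q1 : q < 1 by rewrite ltr_pdivrMr// mul1r.
have rem m : rnorm (d ^+ m.+1 *: iter m.+1 T (Q z f)) <=
    Normc.normc d * rnorm (Q c%:C h) * q ^+ m.
  rewrite -(rnorm_vabs (_ *: _)) vabsZ rnormZp ?normc_ge0//.
  have -> : Normc.normc (d ^+ m.+1) = Normc.normc d ^+ m.+1.
    by apply: complexI; rewrite -normcC normrX normcC rmorphXn.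
  have := vle_rnorm (vabs_ge0 _) (vabs_iter T0 m.+1 (Q z f)).
  move=> /(ler_wpM2l (exprn_ge0 m.+1 d0))/le_trans; apply.
  (* One term of a positive sum lies below its bound [Q c h]. Trading powers of [e] for powers of
     [d] gives the decay [q ^+ m]. *)
  have em : vle ((e ^+ m)%:C *: iter m.+1 T h) (Q c%:C h).
    apply: vle_trans (neumann_le T0 m.+1 (ltW e0) (Qc0 _ (vabs_ge0 _)) (Qc h)).
    rewrite neumannS -rmorphXn addrC; apply: vleDr.
    by apply: neumann_pos; [exact: T0|exact: ltW|exact: vabs_ge0].
  have em0 : 0 <= e ^+ m by rewrite exprn_ge0// ltW.
  have := vle_rnorm _ em; rewrite rnormZp// => emr.
  rewrite exprS -!mulrA; apply: ler_wpM2l => //.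
  rewrite /q expr_div_n [leRHS]mulrCA; apply: ler_wpM2l; first exact: exprn_ge0.
  rewrite ler_pdivlMr ?exprn_gt0// mulrC; apply: emr.
  by apply: vposZ => //; apply: iter_pos => //; exact: vabs_ge0.
apply: vle_approx => r r0.
pose C := Normc.normc d * rnorm (Q c%:C h) + 1.
have C0 : 0 < C by rewrite ltr_wpDl// mulr_ge0// rnorm_ge0.
have [|m mr] := expr_small q0 q1 (e := r / C); first exact: divr_gt0.
exists (vabs (d ^+ m.+1 *: iter m.+1 T (Q z f))).
  rewrite rnorm_vabs (le_lt_trans (rem m))//.
  move: mr; rewrite ltr_pdivlMr// mulrC; apply: le_lt_trans.
  by apply: ler_wpM2r; [exact: exprn_ge0|rewrite lerDl].
rewrite {1}(neumann_rem m.+1 Qz); apply: (vle_trans (vabsD _ _)).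
apply: vleD; last exact: vle_refl.
apply: (vle_trans (vabs_neumann T0 m.+1 f (ltW de))).
exact: (neumann_le T0 m.+1 (ltW e0) (Qc0 _ (vabs_ge0 _)) (Qc _)).
Qed.

(* The discs of center [N] through [c] exhaust the half-plane [Re z > c]. *)
Lemma resolvent_le_real (c : R) z f : c0 < c -> c < complex.Re z ->
  vle (vabs (Q z f)) (Q c%:C (vabs f)).
Proof.
move=> c0c cz.
have c0z := lt_trans c0c cz.
case: z cz c0z => a b /= ca c0a.
(* With [N = a + t + 1], the gap [(N - c)^2 - |N - z|^2] exceeds [2 (t + 1) (a - c) - b^2], which is
   positive since [t (a - c) = b^2]. *)
pose t := b ^+ 2 / (a - c).
have ac : 0 < a - c by rewrite subr_gt0.
have t0 : 0 <= t by rewrite divr_ge0 ?sqr_ge0// ltW.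
have tE : t * (a - c) = b ^+ 2 by rewrite divfK// gt_eqF.
pose N := a + t + 1.
apply: (@resolvent_le_disc N) => //=.
have Nc : 0 < N - c by rewrite /N; lra.
rewrite -[ltRHS]gtr0_norm// -sqrtr_sqr ltr_sqrt ?exprn_gt0//.
rewrite add0r sqrrN -tE /N; nra.
Qed.

(** The bound [Q c h] for [c < a] exceeds [Q a h] by [(a - c) Q a (Q c h)]. As [Q c h] lies below
    [Q c1 h] for a fixed [c1 <= c], this error is at most [(a - c) k] and vanishes as [c] tends to
    [a]. *)
Lemma resolvent_dominates z : c0 < complex.Re z ->
  dominates (Q (complex.Re z)%:C) (Q z).
Proof.
move=> c0z f; set a := complex.Re z in c0z *.
pose c1 := (c0 + a) / 2.
have c01 : c0 < c1 by rewrite /c1; lra.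
have c1a : c1 < a by rewrite /c1; lra.
have h0 := vabs_ge0 f; set h := vabs f in h0 *.
pose k := Q a%:C (Q c1%:C h).
have k0 : vpos k by apply: Q0 => //; exact: Q0.
apply: vle_approx => e e0.
have r0 := rnorm_ge0 k.
pose r := Num.min (a - c1) (e / (rnorm k + 1)).
have r0' : 0 < r by rewrite lt_min subr_gt0 c1a/= divr_gt0// ltr_wpDl.
have [rc re] : r <= a - c1 /\ r * (rnorm k + 1) <= e.
  by rewrite -ler_pdivlMr ?ltr_wpDl// !ge_min !lexx orbT.
pose c := a - r / 2.
have c1c : c1 <= c by rewrite /c; lra.
have c0c : c0 < c by exact: lt_le_trans c1c.
have ca : c < a by rewrite /c; lra.
exists ((a - c)%:C *: k).
  rewrite rnormZp; last by rewrite subr_ge0 ltW.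
  have -> : a - c = r / 2 by rewrite /c; lra.
  nra.
apply: (vle_trans (resolvent_le_real f c0c ca)).
rewrite [X in vle X _](@resolvent_eq a%:C)// -rmorphB.
apply: vleD; first exact: vle_refl.
apply: vleZ; first by rewrite subr_ge0 ltW.
apply: positive_vmono; first exact: Q0.
rewrite [X in vle _ X](@resolvent_eq c%:C)// -rmorphB; apply: vleDr.
apply: vposZ; first by rewrite subr_ge0.
by apply: Q0 => //; exact: Q0.
Qed.

End ResolventDomination.

Section ResolventPositive.
Context {R : realType} {E : complexBanachLatticeType R}.
Variable A : linear_op E.
Implicit Types (z w : R[i]) (f : E).

Lemma eq_op_invertible (X Y : linear_op E) : op_dom X = op_dom Y ->
  op_fun X = op_fun Y -> op_invertible X -> op_invertible Y.
Proof. by move=> dE fE; rewrite /op_invertible /op_inv dE fE. Qed.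

Lemma op_shift_invertible z : (spectral_bound (op_opp A) < (complex.Re z)%:E)%E ->
  op_invertible (op_shift z A).
Proof.
move=> sz; apply: contrapT => nA; move: sz; apply/negP; rewrite -leNgt.
apply: ereal_sup_ubound; exists z => // iA; apply: nA.
apply: eq_op_invertible iA => //=; apply/funext => f /=.
by rewrite opprK.
Qed.

Lemma op_inv_resolvent z w f : op_invertible (op_shift z A) ->
  op_invertible (op_shift w A) ->
  op_inv (op_shift w A) f =
  op_inv (op_shift z A) (f + (z - w) *: op_inv (op_shift w A) f).
Proof.
move=> zA wA; have [D] := op_invP wA f; set g := op_inv _ f => /= gf.
rewrite -[LHS](op_invK zA)//=; congr op_inv.
by rewrite -gf scalerBl [RHS]addrC subrKA.
Qed.

Lemma resolvent_positive_dominates z : resolvent_positive A ->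
  (spectral_bound (op_opp A) < (complex.Re z)%:E)%E ->
  dominates (op_inv (op_shift (complex.Re z)%:C A)) (op_inv (op_shift z A)).
Proof.
move=> [_ Apos] sz.
(* A real [c0] replaces the spectral bound, which may be [-oo]. *)
have [c0 c0z sc0] : exists2 c0 : R, c0 < complex.Re z &
    forall c, c0 < c -> (spectral_bound (op_opp A) < c%:E)%E.
  case: (spectral_bound _) sz => [s|//|_]; last first.
    by exists (complex.Re z - 1) => [|c _]; [rewrite gtrBl|exact: ltNyr].
  by rewrite lte_fin => sz; exists s => // c; rewrite lte_fin.
have inv w : c0 < complex.Re w -> op_invertible (op_shift w A).
  by move=> cw; apply: op_shift_invertible; exact: sc0.
(* Outside the half-plane the zero operator is a default value, so that choice gives a family
   indexed by all of [R[i]]. *)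
have ex w : exists L : {linear E -> E}, c0 < complex.Re w ->
    forall f, L f = op_inv (op_shift w A) f.
  have [cw|cw] := pselect (c0 < complex.Re w); last by exists \0.
  by have [L LE] := op_inv_is_linear (inv _ cw); exists L.
have [Q QE] := choice ex.
move=> f; have := @resolvent_dominates _ _ c0 Q _ _ z c0z f.
rewrite !QE//; apply.
- move=> z' w g cz cw; rewrite -linearZ -linearD !QE//.
  exact: op_inv_resolvent (inv _ cz) (inv _ cw).
- by move=> c cc g g0; rewrite QE//; apply: Apos => //; exact: sc0.
Qed.

End ResolventPositive.

(** * Semigroups *)

Section Semigroup.
Context {R : realType} {E : complexBanachLatticeType R}.
Variable T : R -> {linear E -> E}.
Hypothesis TC0 : C0_semigroup T.
Implicit Types (f g h : E).

Lemma at_right0P (P : R -> Prop) : (\forall t \near 0^'+, P t) ->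
  exists2 d : R, 0 < d & forall t, 0 < t -> t < d -> P t.
Proof.
move=> [d /= d0 dP]; exists d => // t t0 td; apply: dP => //=.
by rewrite sub0r normrN gtr0_norm.
Qed.

(** Uniform boundedness by Baire: right continuity at 0 bounds each orbit on a short interval. The
    index [n] of [F] controls both the length of that interval and the size of the bound. *)
Lemma semigroup_local_bound : exists M, exists2 d : R, 0 <= M /\ 0 < d &
  forall t f, 0 <= t -> t <= d -> rnorm (T t f) <= M * rnorm f.
Proof.
pose F (n : nat) := [set f | forall t : R, 0 <= t -> t <= n.+1%:R^-1 ->
  rnorm (T t f) <= n%:R].
have [n|f|n [f0 [r r0 rF]]] := @baire_cover R E F.
- apply/closed_rnormP => f fF t t0 tn; apply/ler_addgt0Pr => e e0.
  have [N N0 TN] := continuous_rnorm_bound (C0_continuous TC0 t0).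
  have [|g Fg] := fF (e / (N + 1)); first by rewrite divr_gt0// ltr_wpDl.
  rewrite ltr_pdivlMr ?ltr_wpDl// => fg.
  have := ler_rnormD (T t g) (T t (f - g)); rewrite -linearD addrC subrK.
  have := TN (f - g); have := Fg t t0 tn; have := rnorm_ge0 (f - g).
  nra.
- have /cvg_rnormP/(_ 1 ltr01)/at_right0P[d d0 df] := @C0_cvg _ _ _ TC0 f.
  (* An integer above [x] exceeds the orbit bound [rnorm f + 1], and its inverse is less than
     [d]. *)
  pose x := rnorm f + 1 + d^-1; exists (Num.truncn x).+1 => t t0 tn.
  have xn := truncnS_gt x; set n := (Num.truncn x).+1 in tn xn *.
  have di : 0 < d^-1 by rewrite invr_gt0.
  have f0 := rnorm_ge0 f.
  have [t0'|tN0] := eqVneq t 0; first by rewrite t0' (C0_0 TC0); rewrite /x in xn; lra.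
  have tp : 0 < t by rewrite lt_neqAle eq_sym tN0.
  have td : t < d.
    apply: (le_lt_trans tn); rewrite -[ltRHS]invrK ltf_pV2 ?posrE//.
    by rewrite -natr1; rewrite /x in xn; lra.
  have := ler_rnormB f (f - T t f); rewrite opprB addrC subrK.
  by have := df t tp td; rewrite /x in xn; lra.
exists (2 * n%:R * 2 / r), n.+1%:R^-1.
  by split; [rewrite divr_ge0 ?mulr_ge0// ltW|rewrite invr_gt0].
have small t g : 0 <= t -> t <= n.+1%:R^-1 -> rnorm g < r ->
    rnorm (T t g) <= 2 * n%:R.
  move=> t0 tn gr; have := ler_rnormB (T t (g + f0)) (T t f0).
  rewrite -linearB addrK => /le_trans; apply.
  rewrite mulr_natl mulr2n.
  by apply: lerD; apply: rF => //; rewrite ?addrK// subrr rnorm0.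
move=> t f t0 tn; have [->|fN0] := eqVneq f 0.
  by rewrite linear0 rnorm0 mulr0.
have [k k0 [kf kE]] := rescale r0 fN0.
have := small t _ t0 tn kf; rewrite linearZ/= rnormZp ?(ltW k0)//.
rewrite mulrC -ler_pdivlMr// => /le_trans; apply.
by rewrite kE; lra.
Qed.

End Semigroup.

(** * The modulus of an eigenvector along a positive semigroup *)

Section Eigenvector.
Context {R : realType} {E : complexBanachLatticeType R}.
Variable T : R -> {linear E -> E}.
Hypotheses (TC0 : C0_semigroup T) (T0 : positive_semigroup T).
Variable a : R.
Implicit Types (f g h : E).

Lemma supermedian_iter (t : R) h g k : 0 <= t ->
  vle h ((expR (a * t))%:C *: T t h + g) ->
  vle h ((expR (a * (k%:R * t)))%:C *: T (k%:R * t) h +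
         \sum_(j < k) (expR (a * (j%:R * t)))%:C *: T (j%:R * t) g).
Proof.
move=> t0 hT; elim: k => [|k IH].
  rewrite big_ord0 mul0r mulr0 expR0 scale1r (C0_0 TC0) addr0; exact: vle_refl.
apply: (vle_trans IH); rewrite big_ord_recr/= [X in vle _ (_ + X)]addrC addrA.
apply: vleD; last exact: vle_refl.
have kt : 0 <= k%:R * t by rewrite mulr_ge0.
rewrite -natr1 mulrDl mul1r (C0_D TC0)// mulrDr expRD rmorphM -scalerA -scalerDr.
apply: vleZ; first exact: expR_ge0.
by rewrite -linearZ -linearD; apply: positive_vmono => //; exact: T0.
Qed.

Variables (phi : E) (l : R[i]).
Hypothesis phil : (t^-1)%:C *: (T t phi - phi) @[t --> 0^'+] --> - (l *: phi).
Hypothesis la : complex.Re l < a.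

(** Differentiability gives [T t phi = (1 - t l) phi + o(t)]. Taking moduli,
    [|1 - t l| >= 1 - t Re l], and [e^(at) (1 - t Re l) >= 1] for small [t] because [a > Re l]. *)
Lemma eigenvector_step (e : R) : 0 < e -> exists2 d : R, 0 < d &
  forall t, 0 < t -> t < d -> exists2 y, vpos y /\ rnorm y <= t * e &
    vle (vabs phi) ((expR (a * t))%:C *: T t (vabs phi) + (expR (a * t))%:C *: y).
Proof.
move=> e0.
have /cvg_rnormP/(_ e e0)/at_right0P[d d0 dphi] := phil.
set b := complex.Re l; have la' : b < a := la.
(* For [t < s] the term [|a * b|] makes [(1 + a t) (1 - t b) >= 1], and the term [|b| * (a - b)]
   makes [t * |b| <= 1]. *)
pose s := (a - b) / (`|a * b| + `|b| * (a - b) + 1).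
have B0 : 0 < `|a * b| + `|b| * (a - b) + 1.
  by rewrite ltr_wpDl// addr_ge0// mulr_ge0// subr_ge0 ltW.
have s0 : 0 < s by rewrite divr_gt0// subr_gt0.
exists (Num.min d s) => [|t t0]; first by rewrite lt_min d0.
rewrite lt_min => /andP[td ts].
pose y := T t phi - phi + t%:C *: (l *: phi).
have ye : rnorm y <= t * e.
  have -> : y = - (t%:C *: (- (l *: phi) - t^-1%:C *: (T t phi - phi))).
    rewrite scalerBr scalerA -rmorphM divff ?gt_eqF// scale1r scalerN.
    by rewrite opprB opprK.
  by rewrite rnormN rnormZp ?(ltW t0)// ler_pM2l// ltW// dphi.
exists (vabs y); first by rewrite rnorm_vabs; split => //; exact: vabs_ge0.
have h0 := vabs_ge0 phi.
have hTy : vle ((1 - t * b)%:C *: vabs phi) (T t (vabs phi) + vabs y).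
  apply: (@vle_trans _ _ (vabs ((1 - t%:C * l) *: phi))).
    rewrite vabsZ; apply: vleZl => //.
    rewrite -lecR -normcC; apply: le_trans (normc_ge_Re _).
    rewrite lecR; apply: le_trans (ler_norm _).
    by rewrite /b; case: (l) => x z /=; rewrite mul0r subr0.
  have -> : (1 - t%:C * l) *: phi = T t phi - y.
    by rewrite /y opprD addrA subKr scalerBl scale1r scalerA.
  apply: (vle_trans (vabsD _ _)); rewrite vabsN; apply: vleD; last exact: vle_refl.
  exact/positive_dominates/T0/ltW.
rewrite -scalerDr; apply: vle_trans (vleZ (expR_ge0 _) hTy).
rewrite scalerA -rmorphM -[X in vle X _]scale1r; apply: vleZl => //.
have ab : 0 < a - b by rewrite subr_gt0.
have tB : t * (`|a * b| + `|b| * (a - b) + 1) < a - b by rewrite -ltr_pdivlMr.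
have n1 : a * b <= `|a * b| := ler_norm _.
have n2 : b <= `|b| := ler_norm _.
have n3 : 0 <= `|a * b| by [].
have n4 : 0 <= `|b| by [].
have p1 := mulr_ge0 (ltW t0) n3.
have p2 : 0 <= t * `|b| * (a - b) by rewrite !mulr_ge0// ltW.
have tb' : t * `|b| <= 1 by rewrite -(ler_pM2r ab) mul1r; lra.
have tb : t * b <= 1 by apply: le_trans tb'; rewrite ler_pM2l.
have tab : t * (a * b) <= a - b by have := ler_wpM2l (ltW t0) n1; lra.
have p3 : 0 <= t * ((a - b) - t * (a * b)) by rewrite mulr_ge0 ?subr_ge0// ltW.
have e1 := expR_ge1Dx (a * t).
have : (1 + a * t) * (1 - t * b) <= expR (a * t) * (1 - t * b).
  by rewrite ler_wpM2r// subr_ge0.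
lra.
Qed.

(** For times up to [d], where the local bound [M] holds, [n] steps of length [t / n] accumulate [n]
    errors of order [eps * t / n], and [eps] is arbitrary. *)
Lemma eigenvector_supermedian (s : R) : 0 < s ->
  vle (vabs phi) ((expR (a * s))%:C *: T s (vabs phi)).
Proof.
have [M [d [M0 d0] TM]] := semigroup_local_bound TC0.
set h := vabs phi.
have split_time (x y : R) : 0 < x -> 0 < y -> exists2 n, (0 < n)%N & x / n%:R < y.
  move=> x0 y0; exists (Num.truncn (x / y)).+1 => //.
  by rewrite ltr_pdivrMr// mulrC -ltr_pdivrMr// truncnS_gt.
have short t : 0 < t -> t <= d -> vle h ((expR (a * t))%:C *: T t h).
  move=> t0 td; apply: vle_approx => e e0.
  pose K := expR (`|a| * t) * M.
  have K0 : 0 <= K by rewrite mulr_ge0// expR_ge0.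
  pose eps := e / (K * expR (`|a| * t) * t + 1).
  have D0 : 0 < K * expR (`|a| * t) * t + 1.
    by rewrite ltr_wpDl// !mulr_ge0 ?expR_ge0// ltW.
  have [|c c0 step] := @eigenvector_step eps; first exact: divr_gt0.
  have [n n0 nc] := split_time _ _ t0 c0.
  have n0' : n%:R != 0 :> R by rewrite pnatr_eq0 -lt0n.
  have tn0 : 0 < t / n%:R by rewrite divr_gt0// ltr0n.
  have [y [y0 ye] hy] := step _ tn0 nc.
  have := supermedian_iter n (ltW tn0) hy.
  rewrite [n%:R * _]mulrC divfK// => hn.
  eexists; last exact: hn.
  (* Bounds one error term: the two exponential weights are each at most [expR (|a| * t)], and the
     semigroup contributes [M]. *)
  pose B := K * expR (`|a| * t) * (t / n%:R * eps).
  have expM (x : R) : 0 <= x -> x <= t -> expR (a * x) <= expR (`|a| * t).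
    move=> x0 xt; rewrite ler_expR (le_trans (ler_norm _))// normrM (ger0_norm x0).
    by rewrite ler_wpM2l.
  apply: (@le_lt_trans _ _ (n%:R * B)); last first.
    have -> : n%:R * B = K * expR (`|a| * t) * t * eps by rewrite /B; field.
    rewrite /eps mulrA ltr_pdivrMr// mulrC ltr_pM2l// ltrDl.
    exact: ltr01.
  apply: ler_rnorm_sum => j.
  have jt0 : 0 <= j%:R * (t / n%:R) by rewrite mulr_ge0// ltW.
  have jt : j%:R * (t / n%:R) <= t.
    rewrite mulrCA ler_piMr ?(ltW t0)// ler_pdivrMr ?ltr0n// mul1r ler_nat.
    exact/ltnW/ltn_ord.
  rewrite rnormZp ?expR_ge0// linearZ/= rnormZp ?expR_ge0//.
  have Ty : rnorm (T (j%:R * (t / n%:R)) y) <= M * (t / n%:R * eps).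
    by apply: (le_trans (TM _ y jt0 (le_trans jt td))); rewrite ler_wpM2l.
  have -> : B = expR (`|a| * t) * (expR (`|a| * t) * (M * (t / n%:R * eps))).
    by rewrite /B /K; ring.
  apply: ler_pM; rewrite ?mulr_ge0 ?expR_ge0 ?rnorm_ge0//; first exact: expM.
  apply: ler_pM; rewrite ?expR_ge0 ?rnorm_ge0//; apply: expM; first exact: ltW.
  by rewrite ler_pdivrMr ?ltr0n// ler_peMr ?(ltW t0)// ler1n.
(* Longer times are cut into pieces below [d], now iterated with zero error. *)
move=> s0; have [n n0 nd] := split_time _ _ s0 d0.
have n0' : n%:R != 0 :> R by rewrite pnatr_eq0 -lt0n.
have sn0 : 0 < s / n%:R by rewrite divr_gt0// ltr0n.
have := @supermedian_iter (s / n%:R) h 0 n (ltW sn0).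
rewrite addr0 => /(_ (short _ sn0 (ltW nd))).
rewrite [n%:R * _]mulrC divfK// big1 ?addr0// => j _.
by rewrite linear0 scaler0.
Qed.

End Eigenvector.

Lemma eigenvalue_gauge {R : realType} {E : complexBanachLatticeType R}
    (A : linear_op E) (SA SB : R -> {linear E -> E}) (l : R[i]) (rho : E) (t : R) :
  generates (op_opp A) SA -> positive_semigroup SA -> semigroup_dominates SB SA ->
  op_eigenvalue A l -> vpos rho -> op_dom A `<=` gauge_ideal rho -> 0 < t ->
  (- (complex.Re l)%:E <= lne (gauge_norm rho (SB t rho)) * (t^-1)%:E)%E.
Proof.
move=> [SC0 SAA] SA0 SBA [phi [Dphi phi0 Aphi]] rho0 Drho t0.
have phil : (x^-1)%:C *: (SA x phi - phi) @[x --> 0^'+] --> - (l *: phi).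
  by apply/(SAA phi); split => //=; rewrite Aphi.
have h0 := vabs_ge0 phi.
have SB0 := dominates_positive (SBA t (ltW t0)).
(* The strict inequality feeds [eigenvector_supermedian]; [a] then decreases to [Re l]. *)
suff H a : complex.Re l < a -> ((- a)%:E <= lne (gauge_norm rho (SB t rho)) * (t^-1)%:E)%E.
  apply/lee_addgt0Pr => e e0; rewrite -leeBlDr// -EFinN -EFinB.
  by rewrite -opprD; apply: H; rewrite ltrDl.
move=> la; rewrite lee_pdivlMr// -EFinM.
have gE : ((expR (- a * t))%:E <= gauge_norm rho (SB t rho))%E.
  apply: gauge_norm_ge => c c0; rewrite vabs_pos; last exact: SB0.
  move=> SBc; rewrite lee_fin leNgt; apply/negP => ct.
  have ac : expR (a * t) * c < 1.
    by rewrite mulrC -ltr_pdivlMr ?expR_gt0// mul1r -expRN -mulNr.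
  have [b b0 phib] := Drho _ Dphi.
  (* No error term remains, so [gauge_iter] with [d = 0] forces [phi = 0]. *)
  have hle : vle (vabs phi) ((expR (a * t))%:C *: SB t (vabs phi) + (0 : R)%:C *: rho).
    rewrite scale0r addr0.
    apply: (vle_trans (eigenvector_supermedian SC0 SA0 phil la t0)).
    apply: vleZ; first exact: expR_ge0.
    have := SBA t (ltW t0) (vabs phi); rewrite (vabs_pos h0).
    by rewrite vabs_pos//; apply: SA0 => //; exact: ltW.
  have := gauge_iter SB0 rho0 h0 b0 c0 (lexx 0) (expR_ge0 _) ac phib hle SBc.
  rewrite mul0r mul0r rnorm_vabs => phi00.
  have : rnorm phi = 0 by apply/eqP; rewrite eq_le phi00 rnorm_ge0.
  by move/rnorm0_eq0/eqP; apply/negP.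
have -> : ((- a * t)%:E = lne (expR (- a * t))%:E)%E.
  by rewrite lne_EFin ?expR_gt0// expRK.
rewrite lee_lne// in_itv/= leey andbT ?lee_fin ?expR_ge0//.
by apply: le_trans gE; rewrite lee_fin expR_ge0.
Qed.

Unset Implicit Arguments.

Theorem proposition4p1 (R : realType) (E : complexBanachLatticeType R)
    (A : linear_op E) (hA : closed_op A)
    (rho0 : E) (hrho0 : vpos rho0) (hdom : op_dom A `<=` gauge_ideal rho0) :
  [/\
    forall (mu : R[i]) (P : {linear E -> E}),
      op_invertible (op_shift mu A) ->
      continuous P -> dominates P (op_inv (op_shift mu A)) ->
      forall l : R[i], op_approx_eigenvalue A l ->
      (1 <= ereal_inf [set (Normc.normc (l + mu))%:E * gauge_norm rho (P rho)
                      | rho in quasi_interior_above A])%E,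
    resolvent_positive A ->
      forall l : R[i], op_approx_eigenvalue A l ->
      (1 <= ereal_inf
        [set ereal_inf
          [set `|complex.Re (l + mu)|%:E *
               gauge_norm rho
                 (op_inv (op_shift (complex.Re mu)%:C A) rho)
          | mu in [set mu : R[i] |
                    spectral_bound (op_opp A) < (complex.Re mu)%:E]]
        | rho in quasi_interior_above A])%E
  & forall SA : R -> {linear E -> E},
      generates (op_opp A) SA -> positive_semigroup SA ->
      (forall (B : linear_op E) (SB : R -> {linear E -> E}),
        generates (op_opp B) SB -> semigroup_dominates SB SA ->
        forall l : R[i], op_eigenvalue A l ->
        (- ereal_inf
          [set ereal_inf
            [set lne (gauge_norm rho (SB t rho)) * (t^-1)%:E
            | t in [set t : R | (0 < t)%R]]
          | rho in quasi_interior_above A] <= (complex.Re l)%:E)%E)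
      /\
      (forall l : R[i], op_eigenvalue A l ->
        (- ereal_inf
          [set ereal_inf
            [set lne (gauge_norm rho (SA t rho)) * (t^-1)%:E
            | t in [set t : R | (0 < t)%R]]
          | rho in quasi_interior_above A] <= (complex.Re l)%:E)%E)
  ].
Proof.
split.
- move=> mu P Ainv _ PR l Al; apply/ereal_infP => _ [rho [[rho_pos _] Drho] <-].
  exact: (approx_eigenvalue_gauge Ainv PR Al rho_pos Drho).
- move=> Apos l Al; apply/ereal_infP => _ [rho [[rho_pos _] Drho] <-].
  apply/ereal_infP => _ [mu /= smu <-].
  (* Shift [mu] vertically so that [l + z] is real. *)
  pose z : R[i] := complex.Re mu +i* - complex.Im l.
  have -> : `|complex.Re (l + mu)| = Normc.normc (l + z).
    rewrite -normc_real; congr Normc.normc; rewrite /z.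
    by case: (l) (mu) => [x y] [x' y'] /=; congr (_ +i* _); rewrite subrr.
  have sz : (spectral_bound (op_opp A) < (complex.Re z)%:E)%E by [].
  have [Q QE] := op_inv_is_linear (op_shift_invertible (z := (complex.Re mu)%:C) smu).
  rewrite -QE; apply: (approx_eigenvalue_gauge (A := A)) => //.
    exact: op_shift_invertible.
  by move=> f; rewrite QE; exact: (resolvent_positive_dominates (z := z)).
- move=> SA genA SA0.
  have main SB l : semigroup_dominates SB SA -> op_eigenvalue A l ->
      (- ereal_inf
          [set ereal_inf
            [set lne (gauge_norm rho (SB t rho)) * (t^-1)%:E
            | t in [set t : R | (0 < t)%R]]
          | rho in quasi_interior_above A] <= (complex.Re l)%:E)%E.
    move=> SBA Al; rewrite leeNl.
    apply/ereal_infP => _ [rho [[rho_pos _] Drho] <-].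
    apply/ereal_infP => _ [t /= t0 <-].
    exact: (eigenvalue_gauge genA).
  split=> [B SB _ SBA l|l]; apply: main => // t t0.
  exact/positive_dominates/SA0.
Qed.
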